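(* The restricted map $\alpha:\mathcal{T}\to\hat{\mathcal{A}}$ and its inverse map $\bar\alpha:\hat{\mathcal{A}}\to\mathcal{T}$ are size-preserving bijections between Fishburn trees and modified ascent sequences. In particular, for each $n\ge1$ we have $|\mathcal{T}_n|=|\hat{\mathcal{A}}_n|$.
   Context: Write $[n]=\{1,\dots,n\}$. A binary tree is either empty or a triple $T=(L,r,R)$ with $r$ a node (the root) and $L,R$ binary trees (left and right subtree). $V(T)$ is the set of nodes and the size of $T$ is $|V(T)|$. A vertex labeling is a map $\mathfrak{l}:V(T)\to\{1,2,\dots\}$; $\max(T)$ is the largest label, with $\max(\emptyset)=0$. Labeled binary trees are considered up to label-preserving isomorphism of binary trees. $T$ is decreasing if it is empty, or $T=(L,r,R)$ with $L,R$ decreasing and $\mathfrak{l}(r)\ge\max\{\max(L),\max(R)\}$. $T$ is strictly decreasing to the left if it is empty, or $T=(L,r,R)$ with $\mathfrak{l}(r)>\max(L)$ and $L,R$ strictly decreasing to the left. An endotree of size $n$ is a decreasing binary tree of size $n$ that is strictly decreasing to the left and has all labels in $[n]$; it is regular if the set of its labels equals $[k]$ for some $k\le n$. The in-order traversal of $T=(L,r,R)$ traverses $L$ recursively, then visits $r$, then traverses $R$ recursively; $v_i$ is the $i$-th visited node. Put $\mathrm{asctops}(T)=\{v_1\}\cup\{v_i: v_i\text{ has a left child}\}$ and $\mathrm{nub}(T)=\{v_j:\mathfrak{l}(v_i)\ne\mathfrak{l}(v_j)\text{ for each }i<j\}$ (both empty for the empty tree). A Fishburn tree is a regular endotree $T$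 with $\mathrm{nub}(T)=\mathrm{asctops}(T)$; $\mathcal{T}$ is the set of Fishburn trees and $\mathcal{T}_n$ the set of those of size $n$. The in-order sequence of $T$ is $\alpha(T)=\mathfrak{l}(v_1)\mathfrak{l}(v_2)\dots\mathfrak{l}(v_n)$. For a word $x=x_1\dots x_n$ of positive integers, $\bar\alpha(x)$ is the empty tree if $x$ is empty; otherwise, letting $m$ be the index of the leftmost occurrence of $\max_i x_i$, $\bar\alpha(x)=(L,r,R)$ with $\mathfrak{l}(r)=x_m$, $L=\bar\alpha(x_1\dots x_{m-1})$, $R=\bar\alpha(x_{m+1}\dots x_n)$. A Cayley permutation of size $n$ is a word $x=x_1\dots x_n$ (a map $x:[n]\to[n]$) whose set of values is $[k]$ for some $k\le n$. For $x:[n]\to[n]$ put $\mathrm{asctops}(x)=\{(1,x_1)\}\cup\{(i,x_i):1<i\le n,\ x_{i-1}<x_i\}$ and $\mathrm{nub}(x)=\{(\min x^{-1}(j),j):1\le j\le\max(x)\}$ (both empty for the empty word; for a general endofunction only values $j$ that occur are considered). The set of modified ascent sequences is $\hat{\mathcal{A}}=\{x\text{ a Cayley permutation}:\mathrm{asctops}(x)=\mathrm{nub}(x)\}$, and $\hat{\mathcal{A}}_n$ is the set of those of size $n$. *)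

(* Defs.v *)
From mathcomp Require Import all_boot.
From mathcomp Require Import boolp classical_sets functions cardinality.

Set Implicit Arguments.
Unset Strict Implicit.
Unset Printing Implicit Defensive.

Local Open Scope classical_set_scope.

(* Binary trees labeled with natural numbers, up to label-preserving
   isomorphism. Labels are unconstrained here; their positivity is part of
   [endotree], which bounds them below by 1. *)
Inductive tree : Type := Empty | Node of tree & nat & tree.

(* Nodes are addressed by the path from the root: false = left, true = right. *)
Definition node := seq bool.

Fixpoint subtree (T : tree) (v : node) : tree :=
  match T, v with
  | Empty, _ => Empty
  | _, [::] => T
  | Node L _ R, b :: w => subtree (if b then R else L) w
  end.

Definition V (T : tree) : set node := [set v | subtree T v <> Empty].

(* The value 0 is a default outside of [V T]. *)
Definition label (T : tree) (v : node) : nat :=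
  if subtree T v is Node _ r _ then r else 0.

Definition left_child (v : node) : node := rcons v false.

Fixpoint tree_size (T : tree) : nat :=
  if T is Node L _ R then (tree_size L + tree_size R).+1 else 0.

Fixpoint maxlabel (T : tree) : nat :=
  if T is Node L r R then maxn r (maxn (maxlabel L) (maxlabel R)) else 0.

Fixpoint decreasing (T : tree) : bool :=
  if T is Node L r R then
    [&& decreasing L, decreasing R & maxn (maxlabel L) (maxlabel R) <= r]
  else true.

Fixpoint strictly_decreasing_left (T : tree) : bool :=
  if T is Node L r R then
    [&& maxlabel L < r, strictly_decreasing_left L & strictly_decreasing_left R]
  else true.

(* [n] *)
Definition interval1 (n : nat) : set nat := [set i | 1 <= i <= n].

Definition endotree (n : nat) (T : tree) : Prop :=
  [/\ tree_size T = n, decreasing T, strictly_decreasing_left T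
    & label T @` V T `<=` interval1 n].

Definition regular_endotree (n : nat) (T : tree) : Prop :=
  endotree n T /\ exists2 k, k <= n & label T @` V T = interval1 k.

Fixpoint inorder (T : tree) : seq node :=
  if T is Node L _ R then
    map (cons false) (inorder L) ++ [::] :: map (cons true) (inorder R)
  else [::].

(* v_i; indices start at 1. *)
Definition visited (T : tree) (i : nat) : node := nth [::] (inorder T) i.-1.

Definition tree_asctops (T : tree) : set node :=
  [set v | exists2 i, interval1 (tree_size T) i &
     v = visited T i /\ (i = 1 \/ V T (left_child (visited T i)))].

Definition tree_nub (T : tree) : set node :=
  [set v | exists2 j, interval1 (tree_size T) j &
     v = visited T j /\
     forall i, 1 <= i < j -> label T (visited T i) <> label T (visited T j)].

(* \mathcal{T}_n *)
Definition fishburn_trees_of_size (n : nat) : set tree :=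
  [set T | regular_endotree n T /\ tree_nub T = tree_asctops T].

(* \mathcal{T} *)
Definition fishburn_trees : set tree :=
  [set T | exists n, fishburn_trees_of_size n T].

Definition alpha (T : tree) : seq nat := [seq label T v | v <- inorder T].

Definition wmax (x : seq nat) : nat := \max_(a <- x) a.

(* [fuel] bounds the recursion depth; [size x] always suffices (see
   [bar_alphaE]). Since [index] is 0-based, the leftmost maximum is preceded by
   [take m x] and followed by [drop m.+1 x]. *)
Fixpoint bar_alpha_rec (fuel : nat) (x : seq nat) : tree :=
  if fuel is fuel'.+1 then
    if x is [::] then Empty else
    let m := index (wmax x) x in
    Node (bar_alpha_rec fuel' (take m x)) (wmax x)
         (bar_alpha_rec fuel' (drop m.+1 x))
  else Empty.

Definition bar_alpha (x : seq nat) : tree := bar_alpha_rec (size x) x.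

Lemma wmax_mem (x : seq nat) : x != [::] -> wmax x \in x.
Proof.
rewrite /wmax; elim: x => [//|a [|b x] IH] _; first by rewrite big_seq1 inE.
rewrite big_cons in_cons; case: leqP => _; last by rewrite eqxx.
by rewrite IH ?orbT.
Qed.

Lemma bar_alpha_recE (f g : nat) (x : seq nat) :
  size x <= f -> size x <= g -> bar_alpha_rec f x = bar_alpha_rec g x.
Proof.
elim: f g x => [|f IH] [|g] [|a s] //; rewrite /bar_alpha_rec -/bar_alpha_rec.
set x := a :: s => lef leg.
have ltm : index (wmax x) x < size x by rewrite index_mem wmax_mem.
congr Node; apply: IH; rewrite ?size_takel ?size_drop ?(ltnW ltm) //.
- by rewrite -ltnS (leq_trans ltm).
- by rewrite -ltnS (leq_trans ltm).
- by rewrite leq_subLR addSn (leq_trans lef) // ltnS leq_addl.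
- by rewrite leq_subLR addSn (leq_trans leg) // ltnS leq_addl.
Qed.

Lemma bar_alpha0 : bar_alpha [::] = Empty.
Proof. by []. Qed.

Lemma bar_alphaE (x : seq nat) : x != [::] ->
  let m := index (wmax x) x in
  bar_alpha x = Node (bar_alpha (take m x)) (nth 0 x m) (bar_alpha (drop m.+1 x)).
Proof.
move=> x0 m; have xm := wmax_mem x0; rewrite nth_index //.
have ltm : m < size x by rewrite index_mem.
rewrite /bar_alpha; case: x x0 xm @m ltm => [//|a s] _ _ m ltm.
rewrite [LHS]/bar_alpha_rec -/bar_alpha_rec -/m.
congr Node; apply: bar_alpha_recE => //; first by rewrite size_takel // ltnW.
by rewrite size_drop subSS leq_subr.
Qed.

(* x_i; indices start at 1. *)
Definition letter (x : seq nat) (i : nat) : nat := nth 0 x i.-1.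

Definition cayley_permutation (n : nat) (x : seq nat) : Prop :=
  size x = n /\ exists2 k, k <= n & [set` x] = interval1 k.

Definition word_asctops (x : seq nat) : set (nat * nat) :=
  [set p | exists2 i, interval1 (size x) i &
     p = (i, letter x i) /\ (i = 1 \/ letter x i.-1 < letter x i)].

(* [(index j x).+1] is the least (1-based) position of [j] in [x]. *)
Definition word_nub (x : seq nat) : set (nat * nat) :=
  [set p | exists2 j, interval1 (wmax x) j /\ j \in x & p = ((index j x).+1, j)].

(* \hat{\mathcal{A}}_n *)
Definition modified_ascent_sequences_of_size (n : nat) : set (seq nat) :=
  [set x | cayley_permutation n x /\ word_asctops x = word_nub x].

(* \hat{\mathcal{A}} *)
Definition modified_ascent_sequences : set (seq nat) :=
  [set x | exists n, modified_ascent_sequences_of_size n x].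

(* Main.v *)
(* Reading off the maximal label shows that [bar_alpha] recovers a decreasing,
   strictly-decreasing-to-the-left tree from its in-order sequence. In such a
   tree, a node visited after the first one has a left child exactly when its
   label exceeds that of its in-order predecessor: the predecessor lies in the
   left subtree if there is one, and is an ancestor otherwise. So the nodes in
   [tree_asctops] and [tree_nub] sit at the in-order positions of the ascent
   tops and of the first occurrences in the word, and the two defining equalities
   match. *)
Require Import Defs.
From mathcomp Require Import all_boot.
From mathcomp Require Import boolp classical_sets functions cardinality.

Set Implicit Arguments.
Unset Strict Implicit.
Unset Printing Implicit Defensive.

Local Open Scope classical_set_scope.

(** * Maxima of words and the in-order sequence of a tree *)

Lemma wmax_cat (x y : seq nat) : wmax (x ++ y) = maxn (wmax x) (wmax y).
Proof. by rewrite /wmax big_cat. Qed.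

Lemma wmax_cons (a : nat) (x : seq nat) : wmax (a :: x) = maxn a (wmax x).
Proof. by rewrite /wmax big_cons. Qed.

Lemma leq_wmax (x : seq nat) (a : nat) : a \in x -> a <= wmax x.
Proof.
elim: x => [//|b x IH]; rewrite inE wmax_cons leq_max => /orP[/eqP->|/IH->].
  by rewrite leqnn.
by rewrite orbT.
Qed.

Lemma alpha_Node (L R : tree) (r : nat) :
  alpha (Node L r R) = alpha L ++ r :: alpha R.
Proof. by rewrite /alpha /= map_cat /= -!map_comp. Qed.

Lemma size_inorder (T : tree) : size (inorder T) = tree_size T.
Proof.
by elim: T => [//|L IHL r R IHR] /=; rewrite size_cat /= !size_map IHL IHR addnS.
Qed.

Lemma size_alpha (T : tree) : size (alpha T) = tree_size T.
Proof. by rewrite size_map size_inorder. Qed.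

Lemma wmax_alpha (T : tree) : wmax (alpha T) = maxlabel T.
Proof.
elim: T => [|L IHL r R IHR]; first by rewrite /wmax big_nil.
by rewrite alpha_Node wmax_cat wmax_cons IHL IHR /= maxnCA.
Qed.

(** Each label strictly exceeds the maximum of its left subtree, which is at least 0 even when that
    subtree is empty. *)
Lemma alpha_gt0 (T : tree) (a : nat) :
  strictly_decreasing_left T -> a \in alpha T -> 0 < a.
Proof.
elim: T => [//|L IHL r R IHR] /and3P[Lr sL sR].
rewrite alpha_Node mem_cat inE => /or3P[|/eqP->|]; [exact: IHL| |exact: IHR].
exact: leq_ltn_trans Lr.
Qed.

(** Paths into the two subtrees start with different booleans, so the first step of [v] selects the
    only part of the traversal that can contain it. *)
Lemma mem_inorder (T : tree) (v : node) :
  (v \in inorder T) = (if subtree T v is Node _ _ _ then true else false).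
Proof.
elim: T v => [//|L IHL r R IHR] [|b v] /=; rewrite mem_cat inE ?orbT //=.
have cons_inj c : injective (cons c : node -> node) by move=> u w [].
have cons_neq c d (s : seq node) : c != d -> (c :: v \in map (cons d) s) = false.
  by move=> cd; apply/negP => /mapP[w _ [e _]]; rewrite e eqxx in cd.
by case: b; rewrite (mem_map (@cons_inj _)) cons_neq // ?orbF ?IHL ?IHR.
Qed.

Lemma V_inorder (T : tree) : V T = [set` inorder T].
Proof.
apply/seteqP; split=> v; rewrite /V /= mem_inorder.
  by case: (subtree T v) => [/(_ erefl)|].
by case: (subtree T v).
Qed.

Lemma inorder_uniq (T : tree) : uniq (inorder T).
Proof.
elim: T => [//|L IHL r R IHR] /=.
have cons_inj c : injective (cons c : node -> node) by move=> u w [].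
rewrite cat_uniq /= !map_inj_uniq // IHL IHR /= andbT negb_or -andbA.
apply/and3P; split.
- by apply/mapP => -[].
- by apply/hasPn => _ /mapP[w _ ->]; apply/mapP => -[].
- by apply/mapP => -[].
Qed.

Lemma image_label (T : tree) : label T @` V T = [set` alpha T].
Proof.
rewrite V_inorder; apply/seteqP; split=> [_ [v vT <-]|a /= /mapP[v vT ->]].
  exact: map_f.
by exists v.
Qed.

(** * The maps [alpha] and [bar_alpha] undo each other *)

Lemma bar_alpha_alpha (T : tree) :
  decreasing T -> strictly_decreasing_left T -> bar_alpha (alpha T) = T.
Proof.
elim: T => [//|L IHL r R IHR] /and3P[dL dR LRr] /and3P[Lr sL sR].
have maxr : wmax (alpha (Node L r R)) = r.
  by rewrite wmax_alpha /=; apply/maxn_idPl.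
(* Strictness on the left makes the root the leftmost maximum, at position [size (alpha L)], so
   [bar_alpha] cuts the word exactly there. *)
have rL : r \notin alpha L.
  by apply/negP => /leq_wmax; rewrite wmax_alpha leqNgt Lr.
have idx : index r (alpha (Node L r R)) = size (alpha L).
  by rewrite alpha_Node index_cat (negPf rL) /= eqxx addn0.
rewrite bar_alphaE; last by rewrite alpha_Node; case: (alpha L).
rewrite maxr idx alpha_Node take_size_cat // nth_cat ltnn subnn /=.
by rewrite -cat_rcons drop_size_cat ?size_rcons // IHL // IHR.
Qed.

(** Induction along the recursion of [bar_alpha], with [take] and [drop] replaced by a
    concatenation. The bound on [l] is strict because the cut is at the leftmost maximum. *)
Lemma bar_alpha_ind (P : seq nat -> tree -> Prop) :
  P [::] Defs.Empty ->
  (forall (l r : seq nat) m, (forall a, a \in l -> a < m) -> (forall a, a \in r -> a <= m) ->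
    P l (bar_alpha l) -> P r (bar_alpha r) ->
    P (l ++ m :: r) (Node (bar_alpha l) m (bar_alpha r))) ->
  forall x, P x (bar_alpha x).
Proof.
move=> P0 PN x; have [n] := ssrnat.ubnP (size x); elim: n x => [//|n IH] x xn.
have [->|x0] := eqVneq x [::]; first exact: P0.
have xm := wmax_mem x0; rewrite bar_alphaE // nth_index //.
set m := wmax x in xm *; have ltm : index m x < size x by rewrite index_mem.
have xE : x = take (index m x) x ++ m :: drop (index m x).+1 x.
  by rewrite -{2}(nth_index 0 xm) -drop_nth // cat_take_drop.
rewrite [X in P X]xE; apply: PN.
- move=> a al; have := leq_wmax (mem_take al); rewrite leq_eqVlt => /orP[/eqP am|//].
  by rewrite am in_take ?ltnn in al.
- by move=> a /mem_drop /leq_wmax.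
- by apply: IH; rewrite size_takel ?(ltnW ltm) // (leq_trans ltm).
- apply: IH; rewrite size_drop.
  by rewrite ltn_subLR // (leq_trans xn) // addSn ltnS leq_addl.
Qed.

Lemma alpha_bar_alpha (x : seq nat) : alpha (bar_alpha x) = x.
Proof.
elim/bar_alpha_ind: _ => [//|l r m _ _ IHl IHr].
by rewrite alpha_Node IHl IHr.
Qed.

Lemma wmax_leP (x : seq nat) (m : nat) :
  reflect (forall a, a \in x -> a <= m) (wmax x <= m).
Proof.
apply: (iffP idP) => [xm a /leq_wmax ax|xm]; first exact: leq_trans xm.
by have [->|/wmax_mem/xm//] := eqVneq x [::]; rewrite /wmax big_nil.
Qed.

Lemma maxlabel_bar_alpha (x : seq nat) : maxlabel (bar_alpha x) = wmax x.
Proof. by rewrite -wmax_alpha alpha_bar_alpha. Qed.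

Lemma decreasing_bar_alpha (x : seq nat) : decreasing (bar_alpha x).
Proof.
elim/bar_alpha_ind: _ => [//|l r m lm rm dl dr] /=.
rewrite dl dr !maxlabel_bar_alpha geq_max !andTb.
by apply/andP; split; apply/wmax_leP => // a /lm /ltnW.
Qed.

Lemma strictly_decreasing_left_bar_alpha (x : seq nat) :
  (forall a, a \in x -> 0 < a) -> strictly_decreasing_left (bar_alpha x).
Proof.
elim/bar_alpha_ind: _ => [//|l r m lm rm dl dr] x0 /=.
rewrite dl ?dr => [|a ar|a al]; try by apply: x0; rewrite mem_cat inE ?al ?ar ?orbT.
rewrite maxlabel_bar_alpha !andbT.
(* For empty [l] the condition at the root reads [0 < m]; positivity of the letters enters here. *)
have [->|/wmax_mem/lm//] := eqVneq l [::].
by rewrite /wmax big_nil x0 // mem_cat mem_head orbT.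
Qed.

(* In the induction, [a] plays the role of the label visited just before [T];
   at the top level [maxlabel T <= a] forces a non-ascent at the first node. *)
Lemma left_child_pairmap (T : tree) (a : nat) :
  decreasing T -> strictly_decreasing_left T -> maxlabel T <= a ->
  [seq left_child v \in inorder T | v <- inorder T] =
    pairmap (fun b c => b < c) a (alpha T).
Proof.
elim: T a => [//|L IHL r R IHR] a /and3P[dL dR LRr] /and3P[Lr sL sR].
rewrite /= !geq_max => /and3P[ra La Ra].
have Rr : maxlabel R <= r by move: LRr; rewrite geq_max => /andP[].
(* The traversal of [L] is preceded by [a] and that of [R] by the root label [r]; each bounds the
   labels that follow it. *)
rewrite alpha_Node pairmap_cat /= -IHL // -IHR // map_cat /= -!map_comp.
congr (_ ++ _ :: _).
- by apply: eq_map => v; rewrite -[RHS]/(_ \in _) [LHS](mem_inorder (Node L r R)) mem_inorder.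
(* At the root: if [L] is nonempty, the preceding label is the last letter of [alpha L], which is
   below [r]; otherwise it is [a], and [r <= a] excludes an ascent. *)
- rewrite (mem_inorder (Node L r R)) /=.
  have alphaL b : b \in alpha L -> b < r.
    by move=> /leq_wmax; rewrite wmax_alpha => /leq_ltn_trans; apply.
  transitivity (0 < size (alpha L)); first by rewrite size_alpha; case: (L).
  case: (alpha L) alphaL => [|b s] alphaL /=; first by rewrite [RHS]ltnNge ra.
  by rewrite alphaL // mem_last.
- by apply: eq_map => v; rewrite [LHS](mem_inorder (Node L r R)) mem_inorder.
Qed.

(** * Ascent tops and first occurrences as sets of positions *)

(** Positions are 0-based here and serve words and trees alike. The case [i = 0] is separate since
    [0.-1 = 0] would compare the first letter with itself. *)
Definition ascent_indices (x : seq nat) : set nat :=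
  [set i | i < size x /\ (i = 0 \/ nth 0 x i.-1 < nth 0 x i)].

Definition nub_indices (x : seq nat) : set nat :=
  [set i | i < size x /\ forall j, j < i -> nth 0 x j <> nth 0 x i].

Lemma word_asctopsE (x : seq nat) :
  word_asctops x = (fun i => (i.+1, nth 0 x i)) @` ascent_indices x.
Proof.
apply/seteqP; split=> p.
  move=> [[|i] //= /andP[_ ix] [-> asc]]; exists i => //; split=> //.
  by case: asc => [[]|]; [left|right].
move=> [i [ix asc] <-]; exists i.+1 => //; split=> //.
by case: asc => [->|]; [left|right].
Qed.

Lemma word_nubE (x : seq nat) : (forall a, a \in x -> 0 < a) ->
  word_nub x = (fun i => (i.+1, nth 0 x i)) @` nub_indices x.
Proof.
move=> x0; apply/seteqP; split=> p.
  move=> [a [_ ax] ->]; exists (index a x); last by rewrite nth_index.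
  split; first by rewrite index_mem.
  by move=> j ja; rewrite nth_index //; have/eqP := before_find 0 ja.
move=> [i [ix first_i] <-]; have xi := mem_nth 0 ix.
exists (nth 0 x i); first by split=> //; rewrite /interval1 /= x0 // leq_wmax.
(* An earlier index contradicts that [i] is a first occurrence; a later one contradicts the
   minimality of [index]. *)
have [lt_i|lt_i|->//] := ltngtP (index (nth 0 x i) x) i.
  by have := first_i _ lt_i; rewrite nth_index.
by have := before_find 0 lt_i; rewrite /= eqxx.
Qed.

Lemma nth_alpha (T : tree) (i : nat) : i < tree_size T ->
  nth 0 (alpha T) i = label T (nth [::] (inorder T) i).
Proof. by move=> iT; rewrite (nth_map [::]) ?size_inorder. Qed.

Lemma V_left_child (T : tree) (i : nat) :
  decreasing T -> strictly_decreasing_left T -> 0 < i < tree_size T ->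
  V T (left_child (nth [::] (inorder T) i)) <->
    nth 0 (alpha T) i.-1 < nth 0 (alpha T) i.
Proof.
move=> dT sT /andP[i0 iT]; rewrite V_inorder /=.
(* The start value is [maxlabel T]; it affects only position 0, which [0 < i] excludes. *)
have := left_child_pairmap dT sT (leqnn _).
move=> /(congr1 (fun s => nth false s i)).
rewrite (nth_map [::]) ?size_inorder // => ->.
rewrite (nth_pairmap 0) ?size_alpha //.
by case: i i0 {iT}.
Qed.

Lemma tree_asctopsE (T : tree) : decreasing T -> strictly_decreasing_left T ->
  tree_asctops T = nth [::] (inorder T) @` ascent_indices (alpha T).
Proof.
move=> dT sT; apply/seteqP; split=> v.
  move=> [[|i] //= /andP[_ iT] [-> asc]]; exists i => //.
  split; first by rewrite size_alpha.
  case: i iT asc => [|i] iT; first by left.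
  by case=> [//|/(V_left_child dT sT)]; rewrite iT => asc; right; apply: asc.
move=> [i []]; rewrite size_alpha => iT asc <-.
exists i.+1 => //; split=> //; case: i iT asc => [|i] iT; first by left.
by case=> // asc; right; apply/V_left_child.
Qed.

Lemma tree_nubE (T : tree) :
  tree_nub T = nth [::] (inorder T) @` nub_indices (alpha T).
Proof.
apply/seteqP; split=> v.
  move=> [[|i] //= /andP[_ iT] [-> first_i]]; exists i => //.
  split=> [|j ji]; first by rewrite size_alpha.
  rewrite !nth_alpha ?(ltn_trans ji) //.
  exact: (first_i j.+1).
move=> [i []]; rewrite size_alpha => iT first_i <-.
exists i.+1 => //; split=> // -[//|j] /= ji; rewrite /visited /=.
by rewrite -!nth_alpha ?(ltn_trans (ltnSE ji)) //; apply: first_i.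
Qed.

Lemma image_eqP (aT rT : Type) (f : aT -> rT) (D A B : set aT) :
  set_inj D f -> A `<=` D -> B `<=` D -> f @` A = f @` B <-> A = B.
Proof.
move=> f_inj AD BD; split=> [AB|->//].
suff sub X Y : X `<=` D -> Y `<=` D -> f @` X = f @` Y -> X `<=` Y.
  by apply/seteqP; split; apply: sub.
move=> XD YD XY a Xa; have : (f @` Y) (f a) by rewrite -XY; exists a.
by move=> [b Yb /f_inj <-] //; rewrite inE; [exact: YD|exact: XD].
Qed.

(** Both equalities compare images of the same two sets of positions under injective maps, so each
    says that the two sets of positions agree. *)
Lemma tree_nub_asctops (T : tree) :
  decreasing T -> strictly_decreasing_left T ->
  tree_nub T = tree_asctops T <-> word_asctops (alpha T) = word_nub (alpha T).
Proof.
move=> dT sT.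
rewrite tree_nubE tree_asctopsE // word_asctopsE word_nubE; last first.
  by move=> a; apply: alpha_gt0.
have subA : ascent_indices (alpha T) `<=` [set i | i < tree_size T].
  by move=> i []; rewrite size_alpha.
have subN : nub_indices (alpha T) `<=` [set i | i < tree_size T].
  by move=> i []; rewrite size_alpha.
rewrite (image_eqP _ subA subN); last by move=> i j _ _ [].
rewrite (image_eqP _ subN subA); first by split=> /esym.
(* Injectivity holds only below the size of [T], beyond which [nth] returns its default. *)
move=> i j; rewrite !inE /= -size_inorder => iT jT /eqP.
by rewrite nth_uniq ?inorder_uniq // => /eqP.
Qed.

(** * Transfer between Fishburn trees and modified ascent sequences *)

(** The labels of [T] are the letters of [alpha T]; when they form [interval1 k] with [k <= n], they
    lie in [interval1 n]. *)
Lemma regular_endotreeP (n : nat) (T : tree) :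
  regular_endotree n T <->
  [/\ decreasing T, strictly_decreasing_left T
    & cayley_permutation n (alpha T)].
Proof.
rewrite /regular_endotree /endotree /cayley_permutation image_label size_alpha.
split=> [[[nT dT sT _] labT]|[dT sT [nT labT]]] //; split=> //; split=> //.
case: labT => k kn -> i /andP[i0 ik].
by rewrite /interval1 /= i0 (leq_trans ik).
Qed.

Lemma fishburn_treeP (n : nat) (T : tree) :
  fishburn_trees_of_size n T <->
  [/\ decreasing T, strictly_decreasing_left T
    & modified_ascent_sequences_of_size n (alpha T)].
Proof.
split=> [[/regular_endotreeP[dT sT cT] /(tree_nub_asctops dT sT) ?]|] //.
move=> [dT sT [cT /(tree_nub_asctops dT sT) ?]].
by split=> //; apply/regular_endotreeP.
Qed.

Lemma cayley_permutation_gt0 (n : nat) (x : seq nat) (a : nat) :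
  cayley_permutation n x -> a \in x -> 0 < a <= n.
Proof.
move=> [_ [k kn xk]] ax; have : [set` x] a by [].
by rewrite xk => /andP[-> ak]; apply: leq_trans kn.
Qed.

Lemma fishburn_bar_alpha (n : nat) (x : seq nat) :
  modified_ascent_sequences_of_size n x ->
  fishburn_trees_of_size n (bar_alpha x).
Proof.
move=> xn; apply/fishburn_treeP; rewrite alpha_bar_alpha; split=> //.
  exact: decreasing_bar_alpha.
apply: strictly_decreasing_left_bar_alpha => a.
by case: xn => xn _ /(cayley_permutation_gt0 xn) /andP[].
Qed.

Lemma set_bij_can (aT rT : Type) (A : set aT) (B : set rT)
    (f : aT -> rT) (g : rT -> aT) :
  (forall a, A a -> B (f a)) -> (forall b, B b -> A (g b)) ->
  (forall a, A a -> g (f a) = a) -> (forall b, B b -> f (g b) = b) ->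
  set_bij A B f.
Proof.
move=> AB BA fK gK; split=> [//|a1 a2|b Bb]; last by exists (g b); auto.
by rewrite !inE => Aa1 Aa2 eq_f; rewrite -(fK a1) // eq_f fK.
Qed.

Lemma finite_modified_ascent_sequences (n : nat) :
  finite_set (modified_ascent_sequences_of_size n).
Proof.
(* All letters are at most [n], so every such word comes from a tuple over the finite type
   ['I_n.+1]. *)
pose w (t : n.-tuple 'I_n.+1) : seq nat := map val t.
apply: (@sub_finite_set _ _ (w @` setT)); last exact/finite_image/finite_finset.
move=> x [cx _]; have [sx _] := cx.
have st : size (map (@inord n) x) == n by rewrite size_map sx.
exists (Tuple st) => //; rewrite /w /= -map_comp -[RHS]map_id.
apply/eq_in_map => a /(cayley_permutation_gt0 cx) /andP[_ an].
by rewrite /= inordK.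
Qed.

Theorem corollary4p5 :
  [/\ set_bij fishburn_trees modified_ascent_sequences alpha,
      set_bij modified_ascent_sequences fishburn_trees bar_alpha,
      (forall T, fishburn_trees T -> bar_alpha (alpha T) = T) /\
      (forall x, modified_ascent_sequences x -> alpha (bar_alpha x) = x),
      (forall T, fishburn_trees T -> size (alpha T) = tree_size T) /\
      (forall x, modified_ascent_sequences x -> tree_size (bar_alpha x) = size x)
    & forall n, 1 <= n ->
      [/\ finite_set (fishburn_trees_of_size n),
          finite_set (modified_ascent_sequences_of_size n)
        & (fishburn_trees_of_size n #=
           modified_ascent_sequences_of_size n)%card]].
Proof.
have alphaP n T : fishburn_trees_of_size n T ->
  modified_ascent_sequences_of_size n (alpha T) by case/fishburn_treeP.
have alphaK n T : fishburn_trees_of_size n T -> bar_alpha (alpha T) = T.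
  by case/fishburn_treeP => dT sT _; apply: bar_alpha_alpha.
have AB T : fishburn_trees T -> modified_ascent_sequences (alpha T).
  by case=> n /alphaP; exists n.
have BA x : modified_ascent_sequences x -> fishburn_trees (bar_alpha x).
  by case=> n /fishburn_bar_alpha; exists n.
have AK T : fishburn_trees T -> bar_alpha (alpha T) = T by case=> n /alphaK.
have BK x : modified_ascent_sequences x -> alpha (bar_alpha x) = x.
  by move=> _; apply: alpha_bar_alpha.
split=> //.
- exact: set_bij_can BK.
- exact: set_bij_can AK.
- by split=> [T _|x _]; rewrite -size_alpha ?alpha_bar_alpha.
move=> n _; have finM := finite_modified_ascent_sequences n.
(* Finiteness and equal cardinality both follow once the trees are an image of the words, as
   [bar_alpha] is injective on all words. *)
have -> : fishburn_trees_of_size n =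
    bar_alpha @` modified_ascent_sequences_of_size n.
  apply/seteqP; split=> [T fT|_ [x xn <-]]; last exact: fishburn_bar_alpha.
  by exists (alpha T); [exact: alphaP|exact: alphaK fT].
split=> //; first exact: finite_image.
by apply: inj_card_eq => x y _ _; apply: can_inj alpha_bar_alpha _ _.
Qed.
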